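(* Let $V$ be a finite set with $|V|\ge2$, let $d\colon V\times V\to\mathbb{R}$ be an ultrametric (so $d(x,x)=0$ for all $x$), and let $D=(d(x,y))_{x,y\in V}$. For $x\in V$ let $r(x)=\min\{d(x,y): y\in V\setminus\{x\}\}$. Then: (1) For $x,y\in V$ with $x\neq y$: $d(x,y)\le d(x,z)$ and $d(x,y)\le d(z,y)$ for every $z\in V\setminus\{x,y\}$ if and only if $e_x-e_y$ is an eigenvector of $D$ with eigenvalue $-d(x,y)$. (2) The relation $x\sim y$ iff $x=y$ or $r(x)=r(y)=d(x,y)$ is an equivalence relation on $V$. (3) If $x_1\sim x_2$ and $y_1\sim y_2$, then $d(x_1,y_1)=d(x_2,y_2)$. (4) Let $X_1,\dots,X_k$ be the equivalence classes of $\sim$ and $r(X_i)$ the common value of $r(x)$ for $x\in X_i$. Then the blocks $D|_{X_i\times X_j}$ form an equitable partition of $D$ with equitable quotient matrix $Q=(q_{ij})$, where $q_{ij}=d(x,y)|X_j|$ for $i\neq j$ ($x\in X_i$, $y\in X_j$) and $q_{jj}=r(X_j)(|X_j|-1)$. (5) $\mathcal{E}(D)=\mathcal{E}(Q)+\operatorname{trace}(Q)\ge 2\sum_{i=1}^k(|X_i|-1)\,r(X_i)$.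
   Context: An ultrametric on $V$ is a metric $d$ satisfying $d(x,z)\le\max\{d(x,y),d(y,z)\}$ for all $x,y,z$. $e_v$ denotes standard basis vectors of $\mathbb{R}^V$. An equitable partition of a matrix with respect to a partition $V=X_1\cup\dots\cup X_k$ means each block $D|_{X_i\times X_j}$ has constant row sums $q_{ij}$; $Q=(q_{ij})$ is the equitable quotient matrix. $\mathcal{E}(A)$ is the sum of absolute values of the eigenvalues of $A$.
   Formalization: Part (3) is stated under the extra condition that x_1=y_1 if and only if x_2=y_2; without it (3) fails, e.g. V={a,b}, x_1=y_1=y_2=a, x_2=b gives d(a,a)=0 but d(b,a)>0. *)

(* Defs.v *)
From mathcomp Require Import all_boot all_order all_algebra.
From mathcomp Require Import reals.
From mathcomp.real_closed Require Import complex.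

Set Implicit Arguments.
Unset Strict Implicit.
Unset Printing Implicit Defensive.
Import Order.TTheory GRing.Theory Num.Theory.
Local Open Scope ring_scope.

Section Ultrametric.
Variables (R : realType) (V : finType).
Implicit Types (d : V -> V -> R) (A : 'M[R]_#|V|).

Definition is_metric d : Prop :=
  [/\ forall x y, 0 <= d x y,
      forall x y, d x y = 0 <-> x = y,
      forall x y, d x y = d y x
    & forall x y z, d x z <= d x y + d y z].

Definition is_ultrametric d : Prop :=
  is_metric d /\ forall x y z, d x z <= Num.max (d x y) (d y z).

(* The space R^V is 'cV[R]_#|V|, and matrices indexed by V are 'M[R]_#|V|,
   through the bijection enum_val / enum_rank between 'I_#|V| and V. *)
Definition dist_mx d : 'M[R]_#|V| :=
  \matrix_(i, j) d (enum_val i) (enum_val j).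

Definition basis_vec (x : V) : 'cV[R]_#|V| := delta_mx (enum_rank x) 0.

(* Columns: mathcomp's eigenvalue and eigenspace are about row vectors. *)
Definition is_eigenvector n (A : 'M[R]_n) (a : R) (v : 'cV[R]_n) : Prop :=
  v != 0 /\ A *m v = a *: v.

(* The value 0 is only taken when V = {x}. *)
Definition nearest_dist d (x : V) : R :=
  if [pick y | y != x] is Some y0
  then d x [arg min_(y < y0 | y != x) d x y]%O else 0.

Definition nearest_rel d : rel V := fun x y =>
  (x == y) ||
  ((nearest_dist d x == nearest_dist d y) && (nearest_dist d y == d x y)).

(* Meaningful for a nonempty X on which nearest_dist d is constant. *)
Definition class_dist d (X : {set V}) : R :=
  if [pick x in X] is Some x then nearest_dist d x else 0.

(* X_0, ..., X_(k-1) lists the classes of e, each of them once. *)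
Definition enumerates_classes (e : rel V) k (X : 'I_k -> {set V}) : Prop :=
  injective X /\ [set X i | i : 'I_k] = equivalence_partition e [set: V].

Definition is_equitable_partition A k (X : 'I_k -> {set V}) (Q : 'M[R]_k) :=
  [/\ injective X,
      partition [set X i | i : 'I_k] [set: V]
    & forall i j x, x \in X i ->
        \sum_(y in X j) A (enum_rank x) (enum_rank y) = Q i j].

(* All complex eigenvalues, repeated according to algebraic multiplicity:
   the characteristic polynomial is monic, hence equal to the product of the
   'X - z%:P for z in this sequence. *)
Definition eigenvalues n (A : 'M[R]_n) : seq R[i] :=
  sval (closed_field_poly_normal (char_poly (map_mx (real_complex R) A))).

Definition energy n (A : 'M[R]_n) : R :=
  \sum_(z <- eigenvalues A) Normc.normc z.

End Ultrametric.

Arguments basis_vec R {V} x.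

(* Main.v *)
(* Ultrametric triangles are isosceles with the two longest sides equal; since
   equivalent points are at minimal distance, they are twins: equidistant from
   every other point. Hence D = P M P^T - diag(r), where P is the class
   indicator matrix, M_ij is the distance between the classes X_i and X_j, and
   M_ii = r(X_i). A Weinstein-Aronszajn argument gives
     char(D) = char(Q) * prod_j ('X + r(X_j))^(|X_j| - 1),
   so the spectrum of D is that of Q together with the values - r(X_j), which
   contribute trace(Q) to the energy. The bound is trace(Q) <= E(Q). *)
Require Import Defs.
From mathcomp Require Import all_boot all_order all_algebra.
From mathcomp Require Import reals.
From mathcomp.real_closed Require Import complex.
From mathcomp Require Import ring lra.

Set Implicit Arguments.
Unset Strict Implicit.
Unset Printing Implicit Defensive.
Import Order.TTheory GRing.Theory Num.Theory.
Local Open Scope ring_scope.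

(** * Matrices of twin classes and their characteristic polynomials *)

Definition twin_mx (R : pzRingType) n k (c : 'I_n -> 'I_k) (M : 'M[R]_k)
    (r : 'I_k -> R) : 'M[R]_n :=
  \matrix_(u, v) (M (c u) (c v) - r (c u) *+ (u == v)).

(** With P the class indicator matrix, this is M P^T P - diag(r), since P^T P is the diagonal matrix
    of class sizes. *)
Definition twin_quotient_mx (R : pzRingType) n k (c : 'I_n -> 'I_k)
    (M : 'M[R]_k) (r : 'I_k -> R) : 'M[R]_k :=
  \matrix_(i, j) (M i j *+ #|[set u | c u == j]| - r i *+ (i == j)).

Lemma row_sum_twin_mx (R : pzRingType) n k (c : 'I_n -> 'I_k) (M : 'M[R]_k)
    (r : 'I_k -> R) u j :
  \sum_(v | c v == j) twin_mx c M r u v = twin_quotient_mx c M r (c u) j.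
Proof.
rewrite mxE; under eq_bigr => v /eqP cv do rewrite mxE cv.
rewrite sumrB sumr_const cardsE; congr (_ - _).
have [cu|cu] := eqVneq (c u) j.
  rewrite (bigD1 u) ?cu //= eqxx big1 ?addr0 // => v /andP[_ vu].
  by rewrite eq_sym (negbTE vu).
rewrite big1 // => v /eqP cv; have [uv|//] := eqVneq u v.
by rewrite uv cv eqxx in cu.
Qed.

(* With P the class indicator matrix, twin_mx = P M P^T - diag(r o c), and
   diag(r o c) P = P diag(r). So right multiplication by
   [[1, -P], [0, 'X + diag r]] turns the block matrix
   [[ 'X + diag(r o c), P], [M P^T, 1]], of determinant char_poly (twin_mx c M r),
   into a block lower triangular one. *)
Lemma char_poly_twin_mx (R : comNzRingType) n k (c : 'I_n -> 'I_k)
    (M : 'M[R]_k) (r : 'I_k -> R) :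
  char_poly (twin_mx c M r) * \prod_j ('X + (r j)%:P) =
  \prod_u ('X + (r (c u))%:P) * char_poly (twin_quotient_mx c M r).
Proof.
pose P : 'M[{poly R}]_(n, k) := \matrix_(u, j) (c u == j)%:R.
pose MP : 'M[{poly R}]_(k, n) := \matrix_(i, v) (M i (c v))%:P.
pose Xn : 'M[{poly R}]_n := diag_mx (\row_u ('X + (r (c u))%:P)).
pose Xk : 'M[{poly R}]_k := diag_mx (\row_j ('X + (r j)%:P)).
pose B := block_mx Xn P MP 1%:M.
have detB : \det B = char_poly (twin_mx c M r).
  (* Schur complement of the identity block: the characteristic matrix is [Xn - P *m MP]. *)
  have -> : B = block_mx 1%:M P 0 1%:M *m
                block_mx (char_poly_mx (twin_mx c M r)) 0 MP 1%:M.
    rewrite mulmx_block !mul1mx !mulmx1 !mul0mx !add0r; congr block_mx.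
    apply/matrixP=> u v; rewrite !mxE (bigD1 (c u)) //= big1 ?addr0.
      rewrite !mxE eqxx mul1r; have [->|_] := eqVneq u v.
        by rewrite !mulr1n polyCB; ring.
      by rewrite !mulr0n sub0r subr0 addNr.
    by move=> j cj; rewrite !mxE eq_sym (negbTE cj) mul0r.
  by rewrite det_mulmx det_ublock det_lblock !det1 !mulr1 mul1r.
have mulB : B *m block_mx 1%:M (- P) 0 Xk =
            block_mx Xn 0 MP (char_poly_mx (twin_quotient_mx c M r)).
  rewrite mulmx_block !mulmx1 !mul1mx !mulmx0 !addr0; congr block_mx.
    apply/matrixP=> u j; rewrite mulmxN mul_diag_mx mul_mx_diag !mxE.
    have [->|_] := eqVneq (c u) j; first by rewrite mulr1 mul1r addNr.
    by rewrite mulr0 mul0r addNr.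
  apply/matrixP=> i j; rewrite mulmxN !mxE.
  have -> : \sum_v MP i v * P v j = (M i j *+ #|[set u | c u == j]|)%:P.
    rewrite polyCMn -sumr_const [RHS]big_mkcond /=; apply: eq_bigr => v _.
    by rewrite !mxE inE; case: eqP => [->|_]; rewrite ?mulr1 ?mulr0.
  rewrite polyCB; case: eqP => [->|_].
    by rewrite !mulr1n; ring.
  by rewrite !mulr0n subr0 addr0 add0r.
have /(congr1 determinant) := mulB.
rewrite det_mulmx detB det_ublock det_lblock det1 mul1r /Xn /Xk !det_diag.
by under eq_bigr do rewrite mxE; under [in RHS]eq_bigr do rewrite mxE.
Qed.

(** * Energy and trace through the complex roots *)

Lemma map_char_poly_eigenvalues (R : realType) n (A : 'M[R]_n) :
  map_poly (real_complex R) (char_poly A) =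
  \prod_(z <- eigenvalues A) ('X - z%:P).
Proof.
rewrite /eigenvalues map_char_poly; case: closed_field_poly_normal => s /= {1}->.
by rewrite (monicP (char_poly_monic _)) scale1r.
Qed.

Lemma normc_real (R : realType) (x : R) : Normc.normc (real_complex R x) = `|x|.
Proof. by rewrite /= expr0n addr0 sqrtr_sqr. Qed.

(** Over [R[i]] both sides split into monic linear factors, so their roots agree up to permutation;
    the factor with constant term [r i] has the root [- r i], of modulus [|r i|]. *)
Lemma energy_char_poly (R : realType) m n (A : 'M[R]_m) (B : 'M[R]_n)
    (I J : finType) (r : I -> R) (s : J -> R) :
  char_poly A * \prod_i ('X + (r i)%:P) =
  \prod_j ('X + (s j)%:P) * char_poly B ->
  energy A + \sum_i `|r i| = \sum_j `|s j| + energy B.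
Proof.
have factors (K : finType) (t : K -> R) :
    map_poly (real_complex R) (\prod_i ('X + (t i)%:P)) =
    \prod_(z <- [seq real_complex R (- t i) | i : K]) ('X - z%:P).
  rewrite rmorph_prod big_image /=; apply: eq_bigr => i _.
  by rewrite rmorphD /= map_polyX map_polyC /= rmorphN /= polyCN opprK.
have normsE (K : finType) (t : K -> R) :
    \sum_i `|t i| =
    \sum_(z <- [seq real_complex R (- t i) | i : K]) Normc.normc z.
  by rewrite big_image; apply: eq_bigr => i _; rewrite normc_real normrN.
move=> /(congr1 (map_poly (real_complex R))).
rewrite !rmorphM /= !factors !map_char_poly_eigenvalues -!big_cat /=.
by move=> /prod_XsubC_eq eq_roots; rewrite !normsE -!big_cat /=; apply: perm_big.
Qed.

(** The trace is the sum of the real parts of the eigenvalues, and Re z <= |z|. The quotient matrix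
    is in general not symmetric, hence the complex setting. *)
Lemma trace_le_energy (R : realType) n (A : 'M[R]_n) : \tr A <= energy A.
Proof.
have normc_ge (z : R[i]) : complex.Re z <= Normc.normc z.
  case: z => a b /=; apply: le_trans (ler_norm a) _.
  by rewrite -sqrtr_sqr ler_wsqrtr // lerDl sqr_ge0.
have -> : \tr A = \sum_(z <- eigenvalues A) complex.Re z.
  have := map_char_poly_eigenvalues A; set s := eigenvalues A => chA.
  have sz : size s = n.
    have := congr1 (fun p : {poly R[i]} => size p) chA.
    by rewrite size_map_poly size_char_poly size_prod_XsubC => -[].
  (* The trace is read off the coefficient of degree [n.-1], which makes sense only for positive
     [n]. *)
  have [n0|n0] := posnP n.
    have/size0nil -> : size s = 0 by rewrite sz.
    rewrite big_nil; move: A {chA sz s}; rewrite n0 => A.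
    by rewrite /mxtrace big_ord0.
  have := congr1 (fun p : {poly R[i]} => p`_n.-1) chA.
  rewrite coef_map char_poly_trace //= -{2}sz coefPn_prod_XsubC ?sz -?lt0n //.
  rewrite rmorphN /= => /oppr_inj /(congr1 (@complex.Re R)) /= ->.
  by rewrite raddf_sum.
by apply: ler_sum => z _; apply: normc_ge.
Qed.

Lemma reindex_enum_val (R : Type) (idx : R) (op : Monoid.com_law idx) (V : finType)
    (P : pred V) (F : V -> R) :
  \big[op/idx]_(u < #|V| | P (enum_val u)) F (enum_val u) =
  \big[op/idx]_(x | P x) F x.
Proof. by rewrite (reindex _ (onW_bij _ (enum_val_bij V))). Qed.

(** * Ultrametric triangles and the nearest-distance relation *)

Section Ultrametric.

Variables (R : realType) (V : finType) (d : V -> V -> R).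
Hypothesis ultra_d : is_ultrametric d.

Lemma ultra_ge0 x y : 0 <= d x y.
Proof. by case: ultra_d => [[]]. Qed.

Lemma ultra_refl x : d x x = 0.
Proof. by case: ultra_d => [[_ d0 _ _] _]; apply/d0. Qed.

Lemma ultra_sym x y : d x y = d y x.
Proof. by case: ultra_d => [[]]. Qed.

Lemma ultra_le x y z a : d x y <= a -> d y z <= a -> d x z <= a.
Proof.
case: ultra_d => _ /(_ x y z) dxz xy yz; apply: le_trans dxz _.
by rewrite ge_max xy.
Qed.

(** A shortest side drops out of the ultrametric inequality, so each of the other two sides bounds
    the other. *)
Lemma ultra_isosceles x y z : d x y <= d x z -> d x y <= d z y -> d x z = d y z.
Proof.
move=> xz zy; apply/le_anti; rewrite (ultra_sym y z).
by rewrite (@ultra_le x y z) // 1?(ultra_sym y z) // (@ultra_le z x y) // ultra_sym.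
Qed.

Lemma nearest_dist_le x y : y != x -> nearest_dist d x <= d x y.
Proof.
move=> yx; rewrite /nearest_dist; case: pickP => [y0 y0x|/(_ y)]; last by rewrite yx.
by case: arg_minP => // z _ /(_ y yx).
Qed.

Lemma nearest_dist_ge0 x : 0 <= nearest_dist d x.
Proof. by rewrite /nearest_dist; case: pickP => // y0 _; apply: ultra_ge0. Qed.

Lemma nearest_relP x y :
  reflect (x = y \/ nearest_dist d x = d x y /\ nearest_dist d y = d x y)
          (nearest_rel d x y).
Proof.
apply: (iffP orP) => [] [/eqP|]; [by left| |by left|].
  by case/andP=> /eqP -> /eqP ->; right.
by case=> -> ->; right; rewrite !eqxx.
Qed.

Lemma nearest_rel_refl : reflexive (nearest_rel d).
Proof. by move=> x; rewrite /nearest_rel eqxx. Qed.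

Lemma nearest_rel_sym : symmetric (nearest_rel d).
Proof.
suff imp x y : nearest_rel d x y -> nearest_rel d y x.
  by move=> x y; apply/idP/idP; apply: imp.
by case/nearest_relP=> [->|[]]; [apply: nearest_rel_refl|];
  rewrite (ultra_sym x) => rx ry; apply/nearest_relP; right.
Qed.

Lemma nearest_rel_trans : transitive (nearest_rel d).
Proof.
move=> y x z /nearest_relP[->//|[rx ry]] /nearest_relP[<-|[ry' rz]].
  by apply/nearest_relP; right.
apply/nearest_relP; have [->|xz] := eqVneq x z; [by left | right].
(* All three nearest distances equal [d x y]: the ultrametric inequality gives one bound on [d x z],
   minimality at [x] the other. *)
suff e : d x z = d x y by rewrite rx rz -ry' ry e.
apply/le_anti; rewrite (@ultra_le x y z) //= -?ry' ?ry //.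
by rewrite -rx nearest_dist_le // eq_sym.
Qed.

(** The side from [x1] to [x2] is minimal at both of its ends, hence a shortest side of the triangle
    with apex [y]. *)
Lemma nearest_rel_dist x1 x2 y :
  nearest_rel d x1 x2 -> y != x1 -> y != x2 -> d x1 y = d x2 y.
Proof.
case/nearest_relP=> [->//|[r1 r2]] y1 y2; apply: ultra_isosceles.
  by rewrite -r1 nearest_dist_le.
by rewrite -r2 ultra_sym nearest_dist_le.
Qed.

(** The first hypothesis keeps a zero distance [d x x] from being compared with the positive
    distance between two points of one class. The endpoints are then moved one at a time, through
    [d x2 y1]. *)
Lemma nearest_rel_dist2 x1 x2 y1 y2 :
  (x1 = y1 <-> x2 = y2) -> nearest_rel d x1 x2 -> nearest_rel d y1 y2 ->
  d x1 y1 = d x2 y2.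
Proof.
move=> eq_xy x12 y12.
have [e1|n1] := eqVneq x1 y1; first by rewrite -(eq_xy.1 e1) e1 !ultra_refl.
have [e2|n2] := eqVneq x2 y2; first by rewrite (eq_xy.2 e2) eqxx in n1.
(* If [y1 = x2], the intermediate distance is 0; but then both distances are the nearest distance of
   [x2]. *)
have [e|y1x2] := eqVneq y1 x2.
  move: x12 y12; rewrite e in n1 *; case/nearest_relP=> [e1|[_ <-]].
    by rewrite e1 eqxx in n1.
  by case/nearest_relP=> [e2|[-> _]//]; rewrite e2 eqxx in n2.
rewrite (nearest_rel_dist x12) // 1?eq_sym // !(ultra_sym x2).
by apply: nearest_rel_dist => //; rewrite eq_sym // eq_sym.
Qed.

Lemma dist_mx_basis_vecB x y u :
  (dist_mx d *m (basis_vec R x - basis_vec R y)) u 0 =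
  d (enum_val u) x - d (enum_val u) y.
Proof. by rewrite mulmxBr -!colE !mxE !enum_rankK. Qed.

(** Away from [x] and [y], the eigenvector equation at [z] says [d z x = d z y], that is, the
    triangle is isosceles with apex [z]. *)
Lemma eigenvector_basis_vecBP x y : x != y ->
  (forall z, z != x -> z != y -> d x y <= d x z /\ d x y <= d z y) <->
  is_eigenvector (dist_mx d) (- d x y) (basis_vec R x - basis_vec R y).
Proof.
move=> xy; have vE u : (basis_vec R x - basis_vec R y) u 0 =
    (enum_val u == x)%:R - (enum_val u == y)%:R.
  by rewrite !mxE !andbT -2!(inj_eq (@enum_rank_inj V)) enum_valK.
split=> [xy_min|[_ eigen] z zx zy].
  split.
    apply/eqP=> /colP/(_ (enum_rank x)).
    rewrite vE mxE enum_rankK eqxx (negbTE xy) subr0 => /eqP.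
    by rewrite oner_eq0.
  apply/colP=> u; rewrite dist_mx_basis_vecB mxE vE.
  have [->|zx] := eqVneq (enum_val u) x.
    by rewrite ultra_refl (negbTE xy) subr0 sub0r mulr1.
  have [->|zy] := eqVneq (enum_val u) y.
    by rewrite ultra_refl sub0r mulrN mulr1 opprK subr0 ultra_sym.
  have [xz yz] := xy_min _ zx zy.
  rewrite subrr mulr0 2!(ultra_sym (enum_val u)).
  by rewrite (ultra_isosceles xz yz) subrr.
have /colP/(_ (enum_rank z)) := eigen; rewrite dist_mx_basis_vecB mxE vE.
rewrite enum_rankK (negbTE zx) (negbTE zy) subrr mulr0 => /subr0_eq zxy.
by split; apply: (@ultra_le _ z); rewrite -?zxy ?(ultra_sym x z).
Qed.

End Ultrametric.

(** * The distance matrix as a twin matrix of its classes *)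

Theorem theorem9 (R : realType) (V : finType) (d : V -> V -> R)
    (card_V : (2 <= #|V|)%N) (ultra_d : is_ultrametric d) :
  (* (1) *)
  (forall x y : V, x != y ->
     (forall z, z != x -> z != y -> d x y <= d x z /\ d x y <= d z y) <->
     is_eigenvector (dist_mx d) (- d x y) (basis_vec R x - basis_vec R y)) /\
  (* (2) *)
  [/\ reflexive (nearest_rel d), symmetric (nearest_rel d)
    & transitive (nearest_rel d)] /\
  (* (3) *)
  (forall x1 x2 y1 y2 : V, (x1 = y1 <-> x2 = y2) ->
     nearest_rel d x1 x2 -> nearest_rel d y1 y2 -> d x1 y1 = d x2 y2) /\
  (forall (k : nat) (X : 'I_k -> {set V}),
     enumerates_classes (nearest_rel d) X ->
     (forall i x, x \in X i -> nearest_dist d x = class_dist d (X i)) /\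
     exists Q : 'M[R]_k,
       (* (4) *)
       [/\ is_equitable_partition (dist_mx d) X Q,
           (forall i j x y, i != j -> x \in X i -> y \in X j ->
              Q i j = d x y * #|X j|%:R)
         & (forall j, Q j j = class_dist d (X j) * (#|X j|%:R - 1))] /\
       (* (5) *)
       energy (dist_mx d) = energy Q + \tr Q /\
       2 * \sum_(i < k) (#|X i|%:R - 1) * class_dist d (X i)
         <= energy Q + \tr Q).
Proof.
split; first exact: eigenvector_basis_vecBP.
have refl_d := nearest_rel_refl d.
have sym_d := nearest_rel_sym ultra_d.
have trans_d := nearest_rel_trans ultra_d.
split; first by split.
split; first exact: nearest_rel_dist2.
move=> k X [X_inj X_classes].
have equiv_d : {in [set: V] & &, equivalence_rel (nearest_rel d)}.
  move=> x y z _ _ _; split=> // xy.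
  by apply/idP/idP; apply: trans_d; rewrite // sym_d.
have X_part : partition [set X i | i : 'I_k] [set: V].
  by rewrite X_classes equivalence_partitionP.
have XP i x : x \in X i -> X i = [set y | nearest_rel d x y].
  have : X i \in [set X i | i : 'I_k] by rewrite imset_f.
  rewrite X_classes => /imsetP[z _ ->]; rewrite !inE /= => zx.
  by apply/setP=> y; rewrite !inE /=; apply: (equiv_d z x y _ _ _).2.
have X_dist i x : x \in X i -> nearest_dist d x = class_dist d (X i).
  move=> xX; rewrite /class_dist; case: pickP => [y|/(_ x)]; last by rewrite xX.
  by rewrite (XP _ _ xX) inE => /nearest_relP[->//|[-> ->]].
split=> //.
have /fin_all_exists[cl clP] : forall x, exists i, x \in X i.
  move=> x; have : x \in cover [set X i | i : 'I_k].
    by rewrite (cover_partition X_part).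
  by case/bigcupP=> _ /imsetP[i _ ->]; exists i.
have memX x i : (x \in X i) = (cl x == i).
  apply/idP/eqP=> [xX|<-//]; apply: X_inj.
  by rewrite (XP _ _ xX) (XP _ _ (clP x)).
have /fin_all_exists[rep repP] : forall i, exists x, x \in X i.
  move=> i; apply/set0Pn; apply: contraTneq X_part => X0.
  by rewrite /partition -X0 imset_f // !andbF.
pose r i := class_dist d (X i).
(* On the diagonal, [r i] is the distance between distinct points of class [i]; subtracting [r] in
   [twin_mx] restores [d x x = 0], also for singleton classes. *)
pose M : 'M[R]_k := \matrix_(i, j) if i == j then r i else d (rep i) (rep j).
pose c (u : 'I_#|V|) := cl (enum_val u).
have r_ge0 i : 0 <= r i by rewrite /r -(X_dist _ _ (repP i)) nearest_dist_ge0.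
have cardX i : #|[set u | c u == i]| = #|X i|.
  rewrite cardsE -!sum1_card (reindex_enum_val _ (fun x => cl x == i) (fun=> 1%N)).
  by apply: eq_bigl => x; rewrite memX.
have repE i j x y : i != j -> x \in X i -> y \in X j ->
    d (rep i) (rep j) = d x y.
  move=> ij xi yj.
  have mem_neq z t : z \in X i -> t \in X j -> z <> t.
    by rewrite !memX => /eqP iz /eqP jt zt; rewrite -iz -jt zt eqxx in ij.
  apply: nearest_rel_dist2 => //.
  - by split=> /mem_neq; case.
  - by have := xi; rewrite (XP _ _ (repP i)) inE.
  - by have := yj; rewrite (XP _ _ (repP j)) inE.
have distE : dist_mx d = twin_mx c M r.
  apply/matrixP=> u v; rewrite !mxE /c.
  have [->|uv] := eqVneq u v; first by rewrite ultra_refl // eqxx subrr.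
  case: eqP => [e|/eqP ne]; last first.
    by rewrite subr0; apply/esym/repE.
  rewrite subr0; have := clP (enum_val v); rewrite -e (XP _ _ (clP _)) inE.
  case/nearest_relP=> [/enum_val_inj e'|[<- _]]; first by rewrite e' eqxx in uv.
  exact: X_dist.
pose Q := twin_quotient_mx c M r.
have trQ : \tr Q = \sum_i (#|X i|%:R - 1) * r i.
  apply: eq_bigr => i _; rewrite !mxE cardX eqxx mulr1n.
  by rewrite mulrBl mul1r mulr_natl.
have energyE : energy (dist_mx d) = energy Q + \tr Q.
  (* As [r] is nonnegative, the absolute values disappear, and the two remaining sums of [r], over
     points and over classes, differ by [\tr Q]. *)
  have := energy_char_poly (char_poly_twin_mx c M r); rewrite -distE -/Q.
  rewrite (eq_bigr r) => [|i _]; last exact: ger0_norm.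
  have -> : \sum_u `|r (c u)| = \sum_i #|X i|%:R * r i.
    rewrite (partition_big c predT) //=; apply: eq_bigr => i _.
    rewrite -cardX cardsE mulr_natl -sumr_const; apply: eq_bigr => u /eqP ->.
    exact: ger0_norm.
  have -> : \tr Q = \sum_i #|X i|%:R * r i - \sum_i r i.
    by rewrite trQ -sumrB; apply: eq_bigr => i _; rewrite mulrBl mul1r.
  by lra.
exists Q; split; last first.
  split=> //; rewrite -trQ mulr_natl mulr2n lerD2r; exact: trace_le_energy.
split.
- split=> // i j x; rewrite memX => /eqP <-.
  rewrite -{2}(enum_rankK x) -/(c _) -row_sum_twin_mx -distE.
  rewrite -(reindex_enum_val _ _ (fun y => dist_mx d _ (enum_rank y))).
  by apply: eq_big => u; rewrite ?memX ?enum_valK.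
- move=> i j x y ij xi yj; rewrite !mxE cardX (negbTE ij) subr0 mulr_natr.
  by rewrite (repE _ _ _ _ ij xi yj).
by move=> j; rewrite !mxE cardX eqxx mulrBr mulr1 mulr_natr.
Qed.
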